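(* Let $(B,\cdot,\circ)$ be a left semi-brace such that $\rho:(B,\circ)\to\mathrm{Map}(B,B)$ is an anti-homomorphism. Then the mapping $r_B:B\times B\to B\times B$ given by $r_B(x,y)=(\lambda_x(y),\rho_y(x))$ is a set-theoretic solution of the Yang-Baxter equation. Furthermore, if $(1_{\circ}B1_{\circ},\cdot,\circ)$ is a left brace, then $r_B^3=r_B$. Moreover, if $1_{\circ}B1_{\circ}=\{1_{\circ}\}$, then $r_B^2=r_B$.
   Context: A left semi-brace is a set $B$ with two operations $\cdot$ and $\circ$ such that $(B,\cdot)$ is a semigroup, $(B,\circ)$ is a group, and $a\circ(bc)=(a\circ b)(a\circ(\overline{a}c))$ for all $a,b,c\in B$ (here $xy$ means $x\cdot y$ and $\overline{a}$ is the inverse of $a$ in $(B,\circ)$). The identity of $(B,\circ)$ is $1_{\circ}$, and $1_{\circ}B1_{\circ}=\{1_{\circ}b1_{\circ}\mid b\in B\}$. A left brace is a left semi-brace whose multiplicative semigroup $(B,\cdot)$ is an abelian group. Maps: $\lambda_a(b)=a\circ(\overline{a}b)$ and $\rho_a(b)=\overline{(\overline{b}a)}\circ a$ for $a,b\in B$. $\rho:a\mapsto\rho_a$ is an anti-homomorphism if $\rho_{a\circ b}=\rho_b\rho_a$ (composition of maps) for all $a,b\in B$. A set-theoretic solution of the Yang-Baxter equation on a set $X$ is a map $r:X\times X\to X\times X$ (not required bijective) with $(r\times\mathrm{id})(\mathrm{id}\times r)(r\times\mathrm{id})=(\mathrm{id}\times r)(r\times\mathrm{id})(\mathrm{id}\times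 r)$ on $X^3$. Powers $r_B^n$ denote iterated composition. *)

(* Defs.v *)
From mathcomp Require Import all_boot.

Set Implicit Arguments.
Unset Strict Implicit.
Unset Printing Implicit Defensive.

Definition is_group (T : Type) (op : T -> T -> T) (e : T) (inv : T -> T)
  : Prop :=
  [/\ associative op, left_id e op, right_id e op,
      left_inverse e inv op & right_inverse e inv op].

Definition is_left_semibrace (B : Type) (dot circ : B -> B -> B)
    (one : B) (bar : B -> B) : Prop :=
  [/\ associative dot, is_group circ one bar &
      forall a b c, circ a (dot b c) = dot (circ a b) (circ a (dot (bar a) c))].

(* [zero] and [opp] are not required a priori to be [one] and [bar]. *)
Definition is_left_brace (B : Type) (dot circ : B -> B -> B)
    (one : B) (bar : B -> B) : Prop :=
  [/\ is_left_semibrace dot circ one bar, commutative dot &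
      exists (zero : B) (opp : B -> B), is_group dot zero opp].

Definition lambda (B : Type) (dot circ : B -> B -> B) (bar : B -> B)
    (a b : B) : B := circ a (dot (bar a) b).

(* The index comes first: [rho dot circ bar a b] is rho_a(b). *)
Definition rho (B : Type) (dot circ : B -> B -> B) (bar : B -> B)
    (a b : B) : B := circ (bar (dot (bar b) a)) a.

Definition rho_antihom (B : Type) (dot circ : B -> B -> B) (bar : B -> B)
  : Prop :=
  forall a b, rho dot circ bar (circ a b)
              =1 rho dot circ bar b \o rho dot circ bar a.

Definition r_B (B : Type) (dot circ : B -> B -> B) (bar : B -> B)
    (p : B * B) : B * B :=
  (lambda dot circ bar p.1 p.2, rho dot circ bar p.2 p.1).

Definition one_B_one (B : Type) (dot : B -> B -> B) (one : B) : B -> Prop :=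
  fun x => exists b, x = dot (dot one b) one.

Definition restricts_to (B : Type) (S : B -> Prop) (op : B -> B -> B)
    (op' : {x : B | S x} -> {x : B | S x} -> {x : B | S x}) : Prop :=
  forall x y, proj1_sig (op' x y) = op (proj1_sig x) (proj1_sig y).

(* The existence of the restrictions says that S is closed under dot and circ;
   the identity and inverses are those of the restricted circ. *)
Definition subset_is_left_brace (B : Type) (S : B -> Prop)
    (dot circ : B -> B -> B) : Prop :=
  exists (dot' circ' : {x : B | S x} -> {x : B | S x} -> {x : B | S x})
         (one' : {x : B | S x}) (bar' : {x : B | S x} -> {x : B | S x}),
    [/\ restricts_to dot dot', restricts_to circ circ' &
        is_left_brace dot' circ' one' bar'].

Definition times_id (X : Type) (r : X * X -> X * X) (t : X * X * X)
  : X * X * X := (r t.1, t.2).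

(* X * X * X is (X * X) * X, hence the reassociation. *)
Definition id_times (X : Type) (r : X * X -> X * X) (t : X * X * X)
  : X * X * X :=
  let: (x, y, z) := t in let: (y', z') := r (y, z) in (x, y', z').

Definition is_YBE_solution (X : Type) (r : X * X -> X * X) : Prop :=
  times_id r \o id_times r \o times_id r
  =1 id_times r \o times_id r \o id_times r.

(* Main.v *)
Require Import Defs.
From mathcomp Require Import all_boot.

(** Write [oo] for the circ-product.  The map [r_B] preserves it:
    [lambda_x(y) oo rho_y(x) = x oo y].  Since [lambda] is always a homomorphism
    and [rho] is here an anti-homomorphism, the two sides of the Yang-Baxter
    equation have the same outer components ([braid_fst], [braid_snd]); both
    also have the same total circ-product, so cancellation in the group
    [(B, oo)] equates the middle components.

    For the powers of [r_B], preservation of the product reduces everything to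
    first components ([eq_pair_circ]).  The anti-homomorphism condition says
    that, after any left multiplication, [lambda_u(bar u oo y)] may be replaced
    by [lambda_u(bar u) y] ([dot_lambda_bar]).  With [u = bar x y], the first
    iterate has first component [lambda_x(y)] and the second one has
    [lambda_x(lambda_u(bar u) y)] ([fst_r_B2]).  As [1] is a middle unit of the
    semigroup ([dot_mid]), only the projection [1 b 1] of the inserted factor
    [b = lambda_u(bar u)] matters ([lambda_corner]).  It is [1] when [1 B 1] is
    trivial, whence [r_B^2 = r_B].

    When [1 B 1] is a left brace, [b |-> 1 b 1] is a homomorphism from the
    semigroup [(B, .)] to an abelian group with zero [1], and [lambda_u(bar u)]
    is a von Neumann inverse of [u], so its projection is the negative of that
    of [u].  At the third iterate a further factor is inserted, and a
    computation in this abelian group shows that its projection cancels that of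
    [lambda_u(bar u)], whence [r_B^3 = r_B]. *)

Section SemiBrace.

Variables (B : Type) (dot circ : B -> B -> B) (one : B) (bar : B -> B).
Hypothesis hB : is_left_semibrace dot circ one bar.

Local Notation "x '**' y" := (dot x y) (at level 40, left associativity).
Local Notation "x 'oo' y" := (circ x y) (at level 40, left associativity).
Local Notation lam := (lambda dot circ bar).
Local Notation rh := (rho dot circ bar).
Local Notation r := (r_B dot circ bar).
Local Notation corner b := (one ** b ** one).

(** * Elementary properties of left semi-braces *)

Lemma dotA : associative dot. Proof. by case: hB. Qed.

Lemma circA : associative circ. Proof. by case: hB => _ []. Qed.

Lemma circ1l : left_id one circ. Proof. by case: hB => _ []. Qed.

Lemma circ1r : right_id one circ. Proof. by case: hB => _ []. Qed.

Lemma circVl : left_inverse one bar circ. Proof. by case: hB => _ []. Qed.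

Lemma circVr : right_inverse one bar circ. Proof. by case: hB => _ []. Qed.

Lemma circ_dot a b c : a oo (b ** c) = (a oo b) ** lam a c.
Proof. by case: hB => _ _; apply. Qed.

Lemma circKl a b : bar a oo (a oo b) = b.
Proof. by rewrite circA circVl circ1l. Qed.

Lemma circVKl a b : a oo (bar a oo b) = b.
Proof. by rewrite circA circVr circ1l. Qed.

Lemma circIl a b c : a oo b = a oo c -> b = c.
Proof. by move=> /(congr1 (circ (bar a))); rewrite !circKl. Qed.

Lemma circIr a b c : b oo a = c oo a -> b = c.
Proof.
by move=> /(congr1 (circ^~ (bar a))); rewrite -!circA circVr !circ1r.
Qed.

Lemma barK a : bar (bar a) = a.
Proof. by apply: (@circIl (bar a)); rewrite circVr circVl. Qed.

Lemma bar_circ a b : bar (a oo b) = bar b oo bar a.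
Proof. by apply: (@circIl (a oo b)); rewrite circVr -circA circVKl circVr. Qed.

Lemma bar_one : bar one = one.
Proof. by rewrite -[LHS]circ1r circVl. Qed.

(** [1] is a middle unit: this is the defining identity of a left semi-brace
    at [a = 1]. *)
Lemma dot_mid b c : b ** one ** c = b ** c.
Proof.
by have := circ_dot one b c; rewrite /lambda bar_one !circ1l dotA.
Qed.

Lemma lambdaM a b c : lam (a oo b) c = lam a (lam b c).
Proof. by rewrite {1}/lambda bar_circ -circA circ_dot circVKl. Qed.

Lemma lambda_dot a b c : lam a (b ** c) = lam a b ** lam a c.
Proof. by rewrite {1}/lambda dotA circ_dot. Qed.

Lemma circ_lambda_rho x y : lam x y oo rh y x = x oo y.
Proof. by rewrite /lambda /rho -circA circVKl. Qed.

Lemma corner_dot a b : corner (a ** b) = corner a ** corner b.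
Proof. by rewrite !dotA !dot_mid -!dotA; congr dot; rewrite !dotA dot_mid. Qed.

(** [lambda_x] sees its argument only after a left multiplication, and [1] can
    be inserted on both sides of an inner factor. *)
Lemma lambda_corner x b y : lam x (b ** y) = lam x (corner b ** y).
Proof. by rewrite /lambda !dotA !dot_mid. Qed.

Lemma circ_r_B p : (r p).1 oo (r p).2 = p.1 oo p.2.
Proof. exact: circ_lambda_rho. Qed.

Lemma eq_pair_circ (p q : B * B) :
  p.1 = q.1 -> p.1 oo p.2 = q.1 oo q.2 -> p = q.
Proof.
by case: p q => [p1 p2] [q1 q2] /= <- /circIl <-.
Qed.

Hypothesis hrho : rho_antihom dot circ bar.

(** * The Yang-Baxter equation *)

Lemma braid_fst x y z : lam (lam x y) (lam (rh y x) z) = lam x (lam y z).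
Proof. by rewrite -!lambdaM circ_lambda_rho. Qed.

Lemma braid_snd x y z : rh (rh z y) (rh (lam y z) x) = rh z (rh y x).
Proof.
have hA a b c : rh b (rh a c) = rh (a oo b) c by rewrite hrho.
by rewrite !hA circ_lambda_rho.
Qed.

Lemma r_B_YBE : is_YBE_solution r.
Proof.
case=> [[x y] z]; rewrite /times_id /id_times /r_B /=.
rewrite braid_fst braid_snd; congr (_, _, _).
apply: (@circIl (lam x (lam y z))); apply: (@circIr (rh z (rh y x))).
(* Both sides are now the total product x oo y oo z. *)
transitivity (x oo y oo z).
  rewrite -{1}(braid_fst x y z) circ_lambda_rho -circA circ_lambda_rho circA.
  by rewrite circ_lambda_rho.
rewrite -{1}(braid_snd x y z) -[RHS]circA circ_lambda_rho [RHS]circA.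
by rewrite circ_lambda_rho -[RHS]circA circ_lambda_rho circA.
Qed.

(** * Iterates of r_B *)

(** The anti-homomorphism condition, freed of inverses and of [rho]. *)
Lemma dot_lambda_bar d a b :
  d ** lam a (bar a oo b) = d ** lam a (bar a) ** b.
Proof.
have hA c e : bar c oo ((c oo d) ** (c oo e)) = bar c oo ((c oo d) ** c) ** e.
  have := congr1 bar (hrho c e (bar (c oo d))).
  by rewrite /rho /= !(bar_circ, barK) -circA => /circIl.
by have := hA (bar a) b; rewrite !circ_dot barK circVKl.
Qed.

Lemma fst_r_B2 x y (u := bar x ** y) :
  (r (r (x, y))).1 = lam x (lam u (bar u) ** y).
Proof.
rewrite /= {2}/lambda -/u /rho -/u lambdaM.
by rewrite {1}/lambda dot_lambda_bar -dotA.
Qed.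

Lemma r_B_idem : (forall b, corner b = one) -> forall p, r (r p) = r p.
Proof.
move=> h1 [x y]; apply: eq_pair_circ; last exact: circ_r_B.
by rewrite fst_r_B2 lambda_corner h1 /lambda !dotA dot_mid.
Qed.

(** A substitute for the relation [lambda_u(bar u) = - u] of left braces: it is
    [dot_lambda_bar] with [d], [a] and [b] all equal to [u]. *)
Lemma dot_lambda_bar_inverse u :
  one ** one = one -> u ** lam u (bar u) ** u = u.
Proof.
move=> h11; rewrite -dot_lambda_bar circVl -[X in X ** _]circ1r -circ_dot.
by rewrite h11 circ1r.
Qed.

(** The identity of the restricted circ is idempotent in the group [(B, oo)],
    hence is [1].  The zero of the restricted dot is then also [1], since [1] is
    a middle unit: [z = z z = z 1 z = 1]. *)
Lemma left_brace_corner :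
  subset_is_left_brace (one_B_one dot one) dot circ ->
  [/\ one ** one = one,
      forall a b, corner a ** corner b = corner b ** corner a &
      forall a, exists b, corner b ** corner a = one].
Proof.
case=> [dot' [circ' [e [bar' [hd hc]]]]].
case=> [[dotA' [_ e1 _ _ _] _] dotC' [z [opp [_ z1l z1r oppl oppr]]]].
have eE : sval e = one.
  apply: (@circIl (sval e)); rewrite circ1r.
  by have := hc e e; rewrite e1.
have z1 : sval z = one.
  have := dot_mid (sval z) (sval z).
  by rewrite -[X in _ ** X ** _]eE -!hd !(z1l, z1r) eE => <-.
split.
- by have := hd z z; rewrite z1l z1.
- move=> a b.
  pose ca := exist (one_B_one dot one) (corner a) (ex_intro _ a erefl).
  pose cb := exist (one_B_one dot one) (corner b) (ex_intro _ b erefl).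
  by have := congr1 sval (dotC' ca cb); rewrite !hd.
- move=> a.
  pose ca := exist (one_B_one dot one) (corner a) (ex_intro _ a erefl).
  have := congr1 sval (oppl ca); rewrite hd z1.
  by have [b ->] := proj2_sig (opp ca); exists b.
Qed.

(** With [u = bar x y] and [v = bar x' y'], where [(x', y') = r_B(x, y)], the
    third iterate inserts
    [lambda_u(lambda_v(bar v)) lambda_u(bar u)] in front of [y] in
    [lambda_x(y)]; the proof shows that this factor projects to [1]. *)
Lemma r_B_cube : subset_is_left_brace (one_B_one dot one) dot circ ->
  forall p, r (r (r p)) = r p.
Proof.
case/left_brace_corner=> h11 cC cV [x y].
apply: eq_pair_circ; last by rewrite !circ_r_B.
set u := bar x ** y; set v := bar (lam x y) ** rh y x.
rewrite [r (x, y)]surjective_pairing fst_r_B2 /= -/v.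
set w := lam v (bar v).
have rE : rh y x = bar u oo y by [].
have -> : lam (lam x y) (w ** rh y x)
    = lam x (lam u w ** lam u (bar u) ** y).
  by rewrite {1}[lam x y]/lambda -/u rE lambdaM lambda_dot
             {1}/lambda dotA dot_lambda_bar -!dotA.
rewrite lambda_corner corner_dot.
suff -> : corner (lam u w) ** corner (lam u (bar u)) = one.
  by rewrite /lambda !dotA dot_mid.
have c1l b : one ** corner b = corner b by rewrite !dotA h11.
have cI1 a b : corner a ** corner b = corner a -> corner b = one.
  have [a' a'E] := cV a => /(congr1 (dot (corner a'))).
  by rewrite (dotA _ _ (corner b)) a'E c1l.
have cInv a b : a ** b ** a = a -> corner b ** corner a = one.
  move=> ha; rewrite -corner_dot; apply: (cI1 a).
  by rewrite -corner_dot (dotA a) ha.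
(* Additively, write [U], [K], [V], [W] for the corners of [u],
   [lambda_u(bar u)], [lambda_u(v)] and [lambda_u(w)]: then [K = - U],
   [W = - V], and [V = K + K + U = - U] because the corners of [bar x] and [y]
   add up to [U]. *)
have hU : corner (lam u (bar u)) ** corner u = one.
  exact/cInv/dot_lambda_bar_inverse.
have hW : corner (lam u w) ** corner (lam u v) = one.
  by apply: cInv; rewrite -!lambda_dot dot_lambda_bar_inverse.
have hV : corner (lam u v) = corner (lam u (bar u)).
  have vE : v = (bar u oo bar x) ** (bar u oo y).
    by rewrite /v rE /lambda -/u bar_circ.
  have -> : corner (lam u v)
      = corner (lam u (bar u) ** bar x ** lam u (bar u) ** y).
    by rewrite vE lambda_dot !dotA !dot_lambda_bar.
  rewrite !corner_dot; set K := corner (lam u (bar u)).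
  rewrite -(dotA K) (cC (bar x)) -!(dotA K) -corner_dot -/u hU.
  by rewrite /K -!dotA h11.
by rewrite -hV hW.
Qed.

End SemiBrace.

Theorem theorem5p1 (B : Type) (dot circ : B -> B -> B) (one : B) (bar : B -> B)
  (hB : is_left_semibrace dot circ one bar)
  (hrho : rho_antihom dot circ bar) :
  [/\ is_YBE_solution (r_B dot circ bar),
      subset_is_left_brace (one_B_one dot one) dot circ ->
        iter 3 (r_B dot circ bar) =1 r_B dot circ bar &
      (forall x, one_B_one dot one x <-> x = one) ->
        iter 2 (r_B dot circ bar) =1 r_B dot circ bar].
Proof.
split; first exact: r_B_YBE hB hrho.
  exact: r_B_cube hB hrho.
move=> h1 p; apply: (@r_B_idem _ _ _ _ _ hB hrho _ p) => b.
by apply/h1; exists b.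
Qed.
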